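(* Let $n\in\mathbb{N}$, $k\geq 2$, $u\equiv a_{i_1}a_{i_2}\cdots a_{i_k}$ and $v\equiv a_{j_1}a_{j_2}\cdots a_{j_k}$ with all $a_{i_l},a_{j_l}\in\{a_1,\dots,a_n\}$, and let $S=sgp^+\langle a_1,\dots,a_n\mid u=v\rangle$, where $\{u=v\}$ is a Gröbner–Shirshov basis. If $S$ satisfies one of the following conditions, then $S$ is biautomatic and prefix-automatic: (1) for every $t\geq1$, $v(t)\not\equiv u[t]$ and $v[t]\not\equiv u(t)$; (2) $|con(u)|=k$; (3) $k=2$; (4) $con(u)\not\subseteq con(v)$; (5) $u\not\equiv ww'w$ and $v\not\equiv ss's$ for all $w,s\in\{a_1,\dots,a_n\}^+$ and $w',s'\in\{a_1,\dots,a_n\}^*$.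
   Context: $A^*$ is the free monoid (empty word $\varepsilon$), $A^+=A^*\setminus\{\varepsilon\}$, $\equiv$ denotes equality of words, $|w|$ length, $con(w)$ the set of letters occurring in $w$. $sgp^+\langle A\mid R\rangle$ is $A^+$ modulo the congruence generated by $R$. For $\alpha\equiv c_1\cdots c_k$ ($c_i\in A$) and $t\geq1$: $\alpha(t)$ is the prefix of length $t$ ($\alpha(t)\equiv\alpha$ if $t>k$) and $\alpha[t]$ is the suffix of length $t$ ($\alpha[t]\equiv\alpha$ if $t>k$). Gröbner–Shirshov bases: fix a well-ordering of $A$ and the deg-lex ordering on $A^*$ (length, then lexicographic); relations $u=v$ are written with $u>v$. For monic polynomials $f,g$ in the free associative algebra $F\langle A\rangle$ over a field with leading words $\bar f,\bar g$: if $w\equiv\bar f b\equiv a\bar g$ with $|\bar f|+|\bar g|>|w|$, $(f,g)_w=fb-ag$; if $w\equiv\bar f\equiv a\bar g b$, $(f,g)_w=f-agb$. It is trivial modulo $(R,w)$ if it equals $\sum\alpha_i a_i s_i b_i$ with $\alpha_i\in F$, $s_i\in R$, $a_i\bar{s_i}b_i<w$. $R$ is a Gröbner–Shirshov basis if all compositions are trivial; a set of relations $\{u=v\}$ is one if $\{u-v\}$ is. Automaticity: regular = accepted by a finite automaton. With $\$\notin A$, $A(2,\$)=(A\cup\{\$\})^2\setminus\{(\$,\$)\}$; $(\alpha,\beta)\delta_A^R$ (resp. $\delta_A^L$) is the word over $A(2,\$)$ obtained by padding the shorter word on the right (resp. left) with $\$$'s and reading letter pairs. For $S$ generated by finite $A$,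 $\phi:A^+\to S$ canonical, $L\subseteq A^+$ regular with $\phi(L)=S$, write $\alpha=\beta$ if $\phi(\alpha)=\phi(\beta)$, and for $a\in A\cup\{\varepsilon\}$: $L_a^\$=\{(\alpha,\beta)\delta^R_A:\alpha a=\beta\}$, ${}^\$L_a=\{(\alpha,\beta)\delta^L_A:\alpha a=\beta\}$, ${}_aL^\$=\{(\alpha,\beta)\delta^R_A:a\alpha=\beta\}$, ${}^\$_aL=\{(\alpha,\beta)\delta^L_A:a\alpha=\beta\}$ (with $\alpha,\beta\in L$). $S$ is automatic if some such $(A,L)$ has all $L_a^\$$ regular; biautomatic if some $(A,L)$ has all four families regular; prefix-automatic if some automatic structure $(A,L)$ also has $\{(\alpha,\beta)\delta_A^R:\alpha\in L,\beta\in\mathrm{Pref}(L),\alpha=\beta\}$ regular. *)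

(* Defs.v *)
From HB Require Import structures.
From mathcomp Require Import all_boot all_order all_algebra all_fingroup.
From Stdlib Require Import Relation_Operators.
From Stdlib Require List.
Set Implicit Arguments. Unset Strict Implicit. Unset Printing Implicit Defensive.
Import GRing.Theory.

Definition word (n : nat) := seq 'I_n.

Record dfa (Sigma : finType) := Dfa {
  dfa_state : finType;
  dfa_start : dfa_state;
  dfa_final : dfa_state -> bool;
  dfa_trans : dfa_state -> Sigma -> dfa_state }.

Definition dfa_accept (Sigma : finType) (D : dfa Sigma) (w : seq Sigma) : bool :=
  @dfa_final _ D (foldl (@dfa_trans _ D) (@dfa_start _ D) w).

Definition regular (Sigma : finType) (P : seq Sigma -> Prop) : Prop :=
  exists D : dfa Sigma, forall w, dfa_accept D w <-> P w.

Definition pref (T : Type) (t : nat) (s : seq T) := take t s.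
Definition suff (T : Type) (t : nat) (s : seq T) := drop (size s - t) s.

(* Deg-lex ordering on words, the letters being well-ordered by the   *)
(* total order  a < b  iff  sigma a < sigma b  (sigma a permutation). *)
Section DegLex.
Variable n : nat.
Variable sigma : {perm 'I_n}.

Fixpoint lexlt (x y : word n) : bool :=
  match x, y with
  | _, [::] => false
  | [::], _ :: _ => true
  | a :: x', b :: y' => ((sigma a < sigma b)%N) || ((a == b) && lexlt x' y')
  end.

Definition deglt (x y : word n) : bool :=
  (size x < size y)%N || ((size x == size y) && lexlt x y).
End DegLex.

(* Groebner-Shirshov bases for sets of relations  l = r  (polynomial  *)
(* l - r, with leading word l) in the free associative algebra F<A>.  *)
(* Polynomials are represented as formal sums (lists of terms).       *)
Section GS.
Variable F : fieldType.
Variable n : nat.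
Variable sigma : {perm 'I_n}.

Local Open Scope ring_scope.

Definition fpoly := seq (F * word n).

Definition coef (p : fpoly) (x : word n) : F := \sum_(t <- p | t.2 == x) t.1.

Definition peq (p q : fpoly) : Prop := forall x, coef p x = coef q x.

Definition pscale (c : F) (p : fpoly) : fpoly := [seq (c * t.1, t.2) | t <- p].

Definition relpoly (rel : word n * word n) (a b : word n) : fpoly :=
  [:: (1, a ++ rel.1 ++ b); (-1, a ++ rel.2 ++ b)].

Record gsterm := GSTerm {
  gs_coef : F; gs_rel : word n * word n; gs_left : word n; gs_right : word n }.

Definition trivial_mod (R : seq (word n * word n)) (w : word n) (p : fpoly) : Prop :=
  exists T : seq gsterm,
    (forall t, List.In t T ->
        gs_rel t \in R /\
        deglt sigma (gs_left t ++ (gs_rel t).1 ++ gs_right t) w) /\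
    peq p (flatten [seq pscale (gs_coef t) (relpoly (gs_rel t) (gs_left t) (gs_right t))
                   | t <- T]).

Definition GS_basis (R : seq (word n * word n)) : Prop :=
  (* relations are written with leading word on the left *)
  (forall rel, rel \in R -> deglt sigma rel.2 rel.1) /\
  (forall f g, f \in R -> g \in R ->
    (forall w a b : word n,
       w = f.1 ++ b -> w = a ++ g.1 -> (size w < size f.1 + size g.1)%N ->
       trivial_mod R w (relpoly f [::] b ++ pscale (-1) (relpoly g a [::]))) /\
    (forall w a b : word n,
       w = f.1 -> w = a ++ g.1 ++ b ->
       trivial_mod R w (relpoly f [::] [::] ++ pscale (-1) (relpoly g a b)))).
End GS.

(* The semigroup S = sgp+<a_1..a_n | u = v>: nonempty words modulo    *)
(* the congruence generated by u = v.                                 *)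
Section Sgp.
Variable n : nat.
Variables u v : word n.

Definition sstep (x y : word n) : Prop :=
  exists p q : word n, x = p ++ u ++ q /\ y = p ++ v ++ q.

Definition congS : word n -> word n -> Prop := clos_refl_sym_trans _ sstep.

(* A finite generating set A of S: an alphabet B together with an     *)
(* injective map B -> S (elements of S given by representative words) *)
Section Struct.
Variable B : finType.
Variable gen : B -> word n.

Definition gen_ok : Prop :=
  (forall b, gen b != [::]) /\ (forall b b', congS (gen b) (gen b') -> b = b').

Definition phi (al : seq B) : word n := flatten (map gen al).
Definition eqS (al be : seq B) : Prop := congS (phi al) (phi be).

Definition lang_ok (L : seq B -> Prop) : Prop :=
  regular L /\ (forall al, L al -> al != [::]) /\
  (forall x : word n, x != [::] -> exists al, L al /\ congS (phi al) x).

Definition A2 := {p : option B * option B | p != (None, None)}.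

Definition padR (al be : seq B) : seq (option B * option B) :=
  let m := maxn (size al) (size be) in
  zip (map Some al ++ nseq (m - size al) None) (map Some be ++ nseq (m - size be) None).
Definition padL (al be : seq B) : seq (option B * option B) :=
  let m := maxn (size al) (size be) in
  zip (nseq (m - size al) None ++ map Some al) (nseq (m - size be) None ++ map Some be).

Definition owrd (a : option B) : seq B := if a is Some b then [:: b] else [::].

Definition LR (L : seq B -> Prop) (a : option B) (w : seq A2) : Prop :=
  exists al be, L al /\ L be /\ map val w = padR al be /\ eqS (al ++ owrd a) be.
Definition LL (L : seq B -> Prop) (a : option B) (w : seq A2) : Prop :=
  exists al be, L al /\ L be /\ map val w = padL al be /\ eqS (al ++ owrd a) be.
Definition RL (L : seq B -> Prop) (a : option B) (w : seq A2) : Prop :=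
  exists al be, L al /\ L be /\ map val w = padR al be /\ eqS (owrd a ++ al) be.
Definition RLL (L : seq B -> Prop) (a : option B) (w : seq A2) : Prop :=
  exists al be, L al /\ L be /\ map val w = padL al be /\ eqS (owrd a ++ al) be.

Definition PrefL (L : seq B -> Prop) (w : seq A2) : Prop :=
  exists al be, L al /\ be != [::] /\ (exists ga, L (be ++ ga)) /\
                map val w = padR al be /\ eqS al be.
End Struct.

Definition automatic : Prop :=
  exists (B : finType) (gen : B -> word n) (L : seq B -> Prop),
    gen_ok gen /\ lang_ok gen L /\ forall a, regular (LR gen L a).

Definition biautomatic : Prop :=
  exists (B : finType) (gen : B -> word n) (L : seq B -> Prop),
    gen_ok gen /\ lang_ok gen L /\
    forall a, regular (LR gen L a) /\ regular (LL gen L a) /\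
              regular (RL gen L a) /\ regular (RLL gen L a).

Definition prefix_automatic : Prop :=
  exists (B : finType) (gen : B -> word n) (L : seq B -> Prop),
    gen_ok gen /\ lang_ok gen L /\ (forall a, regular (LR gen L a)) /\
    regular (PrefL gen L).
End Sgp.

(* Main.v *)
Require Import Defs.
From mathcomp Require Import all_boot all_order all_algebra all_fingroup.
From mathcomp Require Import boolp zify.
From Stdlib Require Import Relation_Operators.
Set Implicit Arguments. Unset Strict Implicit. Unset Printing Implicit Defensive.

(* Since {u = v} is a Groebner-Shirshov basis, the u-free words are unique normal forms of
   the elements of S: the total coefficient of a class of connected words vanishes on every
   term a (u - v) b of a certificate of triviality, so the two reducts of an overlap are
   connected by reductions below it.  The nonempty u-free words form the language L.

   If x is u-free, reducing x a starts with a u at the right end, and each of the five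
   conditions ensures that every later u straddles the left end of the v produced last: the
   reductions form a cascade moving left.  Such a cascade turns g u'_m ... u'_1 u into
   g v v'_m ... v'_1, where u = u'_i s_i and v = s_i v'_i for nonempty s_i; the blocks u'_i
   and v'_i have the same length, so the relation between x a and its normal form is
   recognised with a buffer of bounded size.  Left multiplication is the mirror image.
   L is closed under nonempty prefixes, hence the prefix relation is equality on L. *)

(** * Regular languages *)

Lemma regular_ext (Sigma : finType) (P Q : seq Sigma -> Prop) :
  (forall w, P w <-> Q w) -> regular P -> regular Q.
Proof. by move=> PQ [D DP]; exists D => w; rewrite DP. Qed.

Definition refines_nerode (Sigma K : finType) (f : seq Sigma -> K)
    (P : seq Sigma -> Prop) : Prop :=
  forall x y z, f x = f y -> P (x ++ z) -> P (y ++ z).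

Lemma regular_nerodeP (Sigma : finType) (P : seq Sigma -> Prop) :
  regular P <-> exists (K : finType) (f : seq Sigma -> K), refines_nerode f P.
Proof.
split=> [[D DP]|[K [f fP]]].
  exists _, (foldl (@dfa_trans _ D) (@dfa_start _ D)) => x y z exy.
  by rewrite -!DP /dfa_accept !foldl_cat exy.
have /choice[rep repP] q : exists x, forall y, f y = q -> f x = q.
  have [[x <-]|nq] := pselect (exists x, f x = q); first by exists x.
  by exists [::] => y fy; case: nq; exists y.
have {}repP x : f (rep (f x)) = f x by exact: repP.
pose D := @Dfa Sigma K (f [::]) (fun q => `[< P (rep q) >]) (fun q c => f (rcons (rep q) c)).
have DP x z : P (rep (foldl (@dfa_trans _ D) (@dfa_start _ D) x) ++ z) <-> P (x ++ z).
  elim/last_ind: x z => [|x c IH] z /=.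
    by rewrite -[X in _ <-> P X]cat0s; split; apply: fP; rewrite repP.
  rewrite foldl_rcons /= cat_rcons -IH -cat_rcons.
  by split; apply: fP; rewrite repP.
by exists D => w; have := DP w [::]; rewrite !cats0 => <-; split=> /asboolP.
Qed.

Lemma regular_and (Sigma : finType) (P Q : seq Sigma -> Prop) :
  regular P -> regular Q -> regular (fun w => P w /\ Q w).
Proof.
move=> /regular_nerodeP[K [f fP]] /regular_nerodeP[K' [f' fQ]].
apply/regular_nerodeP; exists _, (fun w => (f w, f' w)) => x y z [exy exy'] [Px Qx].
by split; [apply: fP Px | apply: fQ Qx].
Qed.

Lemma regular_map (Sigma Gamma : finType) (g : Sigma -> Gamma) (P : seq Gamma -> Prop) :
  regular P -> regular (fun w => P (map g w)).
Proof.
move=> /regular_nerodeP[K [f fP]]; apply/regular_nerodeP.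
by exists K, (fun w => f (map g w)) => x y z exy; rewrite !map_cat; apply: fP.
Qed.

Lemma regular_rev (Sigma : finType) (P : seq Sigma -> Prop) :
  regular P -> regular (fun w => P (rev w)).
Proof.
move=> /regular_nerodeP[K [f fP]]; apply/regular_nerodeP.
exists _, (fun w => [set q | `[< exists2 t, f t = q & P (t ++ rev w) >]]) => x y z.
move=> /setP/(_ (f (rev z))); rewrite !inE !rev_cat => exy Pzx.
have : `[< exists2 t, f t = f (rev z) & P (t ++ rev x) >] by apply/asboolP; exists (rev z).
by rewrite exy => /asboolP[t etz]; apply: fP.
Qed.

Lemma regular_image (Sigma Gamma : finType) (g : Sigma -> Gamma) (P : seq Sigma -> Prop) :
  regular P -> regular (fun w => exists2 x, P x & w = map g x).
Proof.
move=> /regular_nerodeP[K [f fP]]; apply/regular_nerodeP.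
exists _, (fun w => [set q | `[< exists2 x, f x = q & w = map g x >]]) => w1 w2 w.
move=> /setP ew [x Px ex].
have [x1 [x2 [ex12 ew1 ->]]] : exists x1 x2, [/\ x = x1 ++ x2, w1 = map g x1 & w = map g x2].
  exists (take (size w1) x), (drop (size w1) x); rewrite cat_take_drop map_take map_drop -ex.
  by rewrite take_size_cat ?drop_size_cat.
have : f x1 \in [set q | `[< exists2 x, f x = q & w1 = map g x >]].
  by rewrite inE; apply/asboolP; exists x1.
rewrite ew inE => /asboolP[y ey ->]; exists (y ++ x2); last by rewrite map_cat.
by rewrite ex12 in Px; apply: fP Px.
Qed.

Lemma regular_rcons (Sigma : finType) (c : Sigma) (P : seq Sigma -> Prop) :
  regular P -> regular (fun w => exists2 x, P x & w = rcons x c).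
Proof.
move=> /regular_nerodeP[K [f fP]]; set Q := fun w => _; apply/regular_nerodeP.
exists _, (fun w => (f w, `[< Q w >])) => x y z [exy eQ].
case/lastP: z => [|z d]; first by rewrite !cats0 => /asboolP; rewrite eQ => /asboolP.
case=> t Pt; rewrite -rcons_cat => /rcons_inj[xz ->]; exists (y ++ z); last by rewrite rcons_cat.
by move: Pt; rewrite -xz; apply: fP.
Qed.

Definition synchronous (A B : finType) (R : seq A -> seq B -> Prop) : Prop :=
  regular (fun w : seq (A * B) => R (unzip1 w) (unzip2 w)).

(* A rotated track runs one letter ahead of the other one, so besides the state it is enough
   to remember the first pair, whose left letter comes last, and the last pair, whose right
   letter is still unmatched. *)
Lemma synchronous_rot1 (A B : finType) (R : seq A -> seq B -> Prop) :
  synchronous R -> synchronous (fun x y => R (rot 1 x) y).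
Proof.
move=> /regular_nerodeP[K [f fR]]; apply/regular_nerodeP.
pose shifted (w : seq (A * B)) := zip (behead (unzip1 w)) (unzip2 w).
exists _, (fun w => (f (shifted w), ohead w, last None (map Some w))) => w1 w2 w [].
case: w1 w2 => [|c w1] [|d w2] //= ef [ecd]; rewrite !last_map -{}ecd in ef * => -[elast].
have zip_shift a (w' : seq (A * B)) e :
    zip (rcons (unzip1 (w' ++ w)) a) (unzip2 (e :: w' ++ w)) =
    zip (unzip1 w') (unzip2 (e :: w')) ++ zip (rcons (unzip1 w) a) ((last e w').2 :: unzip2 w).
  by elim: w' e => //= c' w' IH e; rewrite -IH.
pose P o := R (unzip1 o) (unzip2 o).
have PE (w' : seq (A * B)) : R (rot 1 (unzip1 (c :: w' ++ w))) (unzip2 (c :: w' ++ w)) <->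
    P (shifted (c :: w') ++ zip (rcons (unzip1 w) c.1) ((last c w').2 :: unzip2 w)).
  by rewrite /P /= -zip_shift rot1_cons unzip1_zip ?unzip2_zip //= size_rcons !size_map.
by rewrite !PE elast; apply: (fR : refines_nerode f P) ef.
Qed.

(** * Words *)

Lemma cat_levi (T : Type) (x y a b : seq T) :
  x ++ y = a ++ b -> size x <= size a -> exists2 c, a = x ++ c & y = c ++ b.
Proof.
elim: x a => [|c x IH] [|d a] //=; first by move=> ->; exists [::].
  by move=> ->; exists (d :: a).
by case=> <- /IH{}IH /IH[e -> ->]; exists e.
Qed.

Lemma two_occurrences (T : Type) (u p q p' q' : seq T) :
  p ++ u ++ q = p' ++ u ++ q' -> size p <= size p' ->
  (exists2 d, p' = p ++ u ++ d & q = d ++ u ++ q') \/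
  exists c b, [/\ p' = p ++ c, q = b ++ q', u ++ b = c ++ u & size c < size u].
Proof.
move=> e /(cat_levi e)[c ->]; have [cu|uc] := ltnP (size c) (size u) => e'.
  move: e'; rewrite catA => /cat_levi[|b eb ->]; first by rewrite size_cat leq_addl.
  by right; exists c, b.
by have [d -> ->] := cat_levi e' uc; left; exists d.
Qed.

Lemma infix_eq_size (T : eqType) (x y : seq T) : size x = size y -> infix x y -> x = y.
Proof.
move=> sxy /infixP[a [b e]]; have := congr1 size e; rewrite !size_cat => se.
have [/size0nil a0 /size0nil b0] : size a = 0 /\ size b = 0 by lia.
by rewrite e a0 b0 cats0.
Qed.

Lemma infix_rcons_suffix (T : eqType) (u x : seq T) a :
  ~~ infix u x -> infix u (rcons x a) -> exists2 g, rcons x a = g ++ u & ~~ infix u g.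
Proof.
move=> ux /infixP[g [t e]]; have t0 : t = [::].
  case/lastP: t e => // t b; rewrite -!rcons_cat => /rcons_inj[ex _].
  by rewrite ex infix_infix in ux.
have u0 : 0 < size u by case: (u) ux => //; rewrite infix0s.
rewrite t0 cats0 in e; exists g => //; apply: contraNN ux => ug.
have sxu : size g <= size x by have := congr1 size e; rewrite size_rcons size_cat; lia.
have [c -> _] := cat_levi (etrans (esym e) (esym (cats1 x a))) sxu.
exact: infix_catr.
Qed.

Lemma infix_cat_suff (T : eqType) (u x z : seq T) :
  infix u (x ++ z) = infix u x || infix u (suff (size u) x ++ z).
Proof.
have ex : x = take (size x - size u) x ++ suff (size u) x by rewrite cat_take_drop.
apply/idP/orP => [/infixP[p [q e]]|[ux|uz]]; first last.
- by rewrite ex -catA; exact: infix_catl.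
- exact: infix_catr.
have [pux|xpu] := leqP (size (p ++ u)) (size x).
  left; move: e; rewrite catA => /esym e; have [c -> _] := cat_levi e pux.
  by rewrite -catA infix_infix.
right; move: e; rewrite {1}ex -catA => e.
have [|c _ ->] := cat_levi e; last exact: infix_infix.
by move: xpu; rewrite size_cat size_takel ?leq_subr // => xpu; lia.
Qed.

(** * Convergence of rewriting *)

Lemma clos_rst_homo (A B : Type) (R : A -> A -> Prop) (S : B -> B -> Prop) (f : A -> B) x y :
  (forall a b, R a b -> S (f a) (f b)) ->
  clos_refl_sym_trans A R x y -> clos_refl_sym_trans B S (f x) (f y).
Proof.
move=> RS; elim=> [a b /RS|a|a b _|a b c _ ab _ bc].
- exact: rst_step.
- exact: rst_refl.
- exact: rst_sym.
- exact: rst_trans ab bc.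
Qed.

Lemma clos_rst_invariant (A B : Type) (R : A -> A -> Prop) (f : A -> B) x y :
  (forall a b, R a b -> f a = f b) -> clos_refl_sym_trans A R x y -> f x = f y.
Proof. by move=> Rf; elim=> [a b /Rf|//|a b _ ->|a b c _ -> _ ->]. Qed.

Section ConnectedPeaks.
Variables (T : Type) (step : T -> T -> Prop) (rank : T -> nat).

Definition irreducible (x : T) : Prop := forall y, ~ step x y.

Definition connected_below (w : T) : T -> T -> Prop :=
  clos_refl_sym_trans T (fun x y => step x y /\ rank x < rank w).

Hypothesis step_rank : forall x y, step x y -> rank y < rank x.

Lemma exists_irreducible_reduct x : exists2 y, clos_refl_trans_1n T step x y & irreducible y.
Proof.
have [m] := ubnP (rank x); elim: m x => // m IH x xm.
have [[y xy]|irr] := pselect (exists y, step x y); last first.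
  by exists x => [|y xy]; [exact: rt1n_refl | apply: irr; exists y].
have [|z yz irr] := IH y; first by have := step_rank xy; lia.
by exists z => //; exact: rt1n_trans yz.
Qed.

Hypothesis peaks_connected :
  forall w x y, step w x -> step w y -> connected_below w x y.

Lemma connected_peaks_unique_normal_form x :
  exists! y, clos_refl_sym_trans T step x y /\ irreducible y.
Proof.
have [nf nfP nf_irr] : exists2 nf, forall x, clos_refl_trans_1n T step x (nf x)
    & forall x, irreducible (nf x).
  have /choice[nf nfP] y : exists z, clos_refl_trans_1n T step y z /\ irreducible z.
    by have [z] := exists_irreducible_reduct y; exists z.
  by exists nf => y; case: (nfP y).
have red_irr y z : clos_refl_trans_1n T step y z -> irreducible y -> z = y.
  by case=> // t u yt _ /(_ _ yt).
have nf_step y z : step y z -> nf y = nf z.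
  have [m] := ubnP (rank y); elim: m y z => // m IH y z ym yz.
  have nf_connected a b : connected_below y a b -> nf a = nf b.
    by apply: clos_rst_invariant => c d [cd cy]; apply: IH cd; lia.
  have nf_red a b : clos_refl_trans_1n T step a b -> rank a < m -> nf a = nf b.
    elim=> // c d e cd _ IHde cm; rewrite (IH _ _ cm cd) IHde //.
    by have := step_rank cd; lia.
  move: (nf y) (nfP y) (nf_irr y) => _ [/(_ _ yz)//|t u yt tu] u_irr.
  have tm : rank t < m by have := step_rank yt; lia.
  rewrite -(nf_connected _ _ (peaks_connected yt yz)) (nf_red _ _ tu tm).
  exact/esym/red_irr.
have nf_conv y z : clos_refl_sym_trans T step y z -> nf y = nf z.
  exact: clos_rst_invariant.
exists (nf x); split=> [|y [/nf_conv -> y_irr]]; last exact: red_irr.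
split=> //; elim: (nfP x) => [y|y z t yz _]; first exact: rst_refl.
by apply: rst_trans; exact: rst_step.
Qed.
End ConnectedPeaks.

(** * Certificates of triviality *)

Section DegLexRank.
Variables (n : nat) (sigma : {perm 'I_n}).

(* Letters are the nonzero digits [1 .. n] in base [n + 1], so that longer words are larger. *)
Definition deglex_rank (x : word n) : nat :=
  foldl (fun m a => m * n.+1 + (sigma a).+1) 0 x.

Lemma deglex_rank_cat x y :
  deglex_rank (x ++ y) = deglex_rank x * n.+1 ^ size y + deglex_rank y.
Proof.
elim/last_ind: y => [|y a IH]; first by rewrite cats0 muln1 addn0.
rewrite -rcons_cat /deglex_rank !foldl_rcons -/(deglex_rank _) -/(deglex_rank y) IH.
by rewrite size_rcons expnSr mulnDl mulnA addnA.
Qed.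

Lemma deglex_rank_cons a x :
  deglex_rank (a :: x) = (sigma a).+1 * n.+1 ^ size x + deglex_rank x.
Proof. by rewrite -cat1s deglex_rank_cat. Qed.

Lemma deglex_rank_lt x : deglex_rank x < n.+1 ^ size x.
Proof.
elim: x => // a x IH; rewrite deglex_rank_cons expnS.
by rewrite addnC [n.+1 * _]mulSn -addSn leq_add // leq_mul.
Qed.

Lemma deglex_rank_size x y : size x < size y -> deglex_rank x < deglex_rank y.
Proof.
case: y => //= a y sxy; apply: leq_trans (deglex_rank_lt x) _.
rewrite deglex_rank_cons; apply: leq_trans (leq_addr _ _).
by rewrite mulSn; apply: leq_trans (leq_addr _ _); rewrite leq_pexp2l.
Qed.

Lemma lexlt_rank x y : size x = size y -> lexlt sigma x y -> deglex_rank x < deglex_rank y.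
Proof.
elim: x y => [|a x IH] [|b y] //= [sxy]; rewrite !deglex_rank_cons -sxy.
case/orP=> [ab|/andP[/eqP-> xy]]; last by rewrite ltn_add2l IH.
apply: leq_trans (leq_addr _ _).
by rewrite addnC [X in _ < X]mulSn -addSn leq_add ?leq_mul // deglex_rank_lt.
Qed.

Lemma deglt_rank x y : deglt sigma x y -> deglex_rank x < deglex_rank y.
Proof. by case/orP=> [/deglex_rank_size//|/andP[/eqP] /lexlt_rank]; apply. Qed.

Lemma deglex_rank_ctx p q x y : deglex_rank x < deglex_rank y ->
  deglex_rank (p ++ x ++ q) < deglex_rank (p ++ y ++ q).
Proof.
move=> xy; have [sxy|syx|sxy] := ltngtP (size x) (size y).
- by apply: deglex_rank_size; rewrite !size_cat; lia.
- by have := deglex_rank_size syx; lia.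
- rewrite !deglex_rank_cat !size_cat sxy ltn_add2l ltn_add2r ltn_mul2r xy andbT.
  by rewrite expn_gt0.
Qed.
End DegLexRank.

Section FormalSums.
Import GRing.Theory.
Local Open Scope ring_scope.
Variables (F : fieldType) (n : nat).
Implicit Types (C : pred (word n)) (p q : fpoly F n).

Definition mass C p : F := \sum_(t <- p | C t.2) t.1.

Lemma mass_cat C p q : mass C (p ++ q) = mass C p + mass C q.
Proof. exact: big_cat. Qed.

Lemma mass_scale C c p : mass C (pscale c p) = c * mass C p.
Proof. by rewrite /mass big_map mulr_sumr. Qed.

Lemma mass_relpoly C rel a b :
  mass C (relpoly F rel a b) = (C (a ++ rel.1 ++ b))%:R - (C (a ++ rel.2 ++ b))%:R.
Proof.
rewrite /mass !big_cons big_nil /=.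
by do 2 case: (C _); rewrite ?(addr0, subr0, sub0r).
Qed.

Lemma mass_coef C p X : uniq X -> {subset map snd p <= X} ->
  mass C p = \sum_(x <- X | C x) coef p x.
Proof.
move=> uX; elim: p => [|t p IH] pX.
  by rewrite /mass big_nil big1 // => x _; rewrite /coef big_nil.
have coef_cons x : coef (t :: p) x = (if t.2 == x then t.1 else 0) + coef p x.
  by rewrite /coef big_cons; case: eqP; rewrite ?add0r.
have {}IH : mass C p = \sum_(x <- X | C x) coef p x.
  by apply: IH => x xp; apply: pX; rewrite inE xp orbT.
rewrite (eq_bigr _ (fun x _ => coef_cons x)) big_split -IH /mass big_cons /=.
rewrite -big_mkcondr /= (eq_bigl (fun x => C t.2 && (x == t.2))); last first.
  by move=> x; rewrite eq_sym; case: eqP => [->|]; rewrite ?andbF.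
case: (C t.2) => /=; last by rewrite big_pred0_eq add0r.
by rewrite -[\sum_(i <- X | _) _]big_filter (filter_pred1_uniq uX) ?big_seq1 // pX // inE eqxx.
Qed.

Lemma mass_peq C p q : peq p q -> mass C p = mass C q.
Proof.
move=> pq; pose X := undup (map snd (p ++ q)).
rewrite !(@mass_coef _ _ X) ?undup_uniq // => [|x xq|x xp].
- by apply: eq_bigr => x _; exact: pq.
- by rewrite mem_undup map_cat mem_cat xq orbT.
- by rewrite mem_undup map_cat mem_cat xp.
Qed.

Definition invariant_below (sigma : {perm 'I_n}) (R : seq (word n * word n)) w C : Prop :=
  forall rel a b, rel \in R -> deglt sigma (a ++ rel.1 ++ b) w ->
    C (a ++ rel.1 ++ b) = C (a ++ rel.2 ++ b).

Lemma mass_trivial_mod sigma R w C p : invariant_below sigma R w C ->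
  trivial_mod sigma R w p -> mass C p = 0.
Proof.
move=> CR [T [T_below /(mass_peq C)->]].
elim: T T_below => [|t T IH] T_below; first by rewrite /mass big_nil.
rewrite map_cons mass_cat IH => [|s sT]; last by apply: T_below; right.
have [tR t_lt] := T_below t (or_introl erefl).
by rewrite mass_scale mass_relpoly CR // subrr mulr0 addr0.
Qed.

(* Of the composition [(f, g)_w] only the masses of [a g.2] and [f.2 b] survive, since the
   leading words cancel. *)
Lemma trivial_composition_invariant sigma R w C f g a b : invariant_below sigma R w C ->
  f.1 ++ b = a ++ g.1 ->
  trivial_mod sigma R w (relpoly F f [::] b ++ pscale (-1) (relpoly F g a [::])) ->
  C (f.2 ++ b) = C (a ++ g.2).
Proof.
move=> CR fbag /(mass_trivial_mod CR)/eqP.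
rewrite mass_cat mass_scale !mass_relpoly /= !cats0 fbag mulN1r opprB addrC subrKA subr_eq0.
by do 2 case: (C _); rewrite // ?oner_eq0 // eq_sym oner_eq0.
Qed.
End FormalSums.

(** * Normal forms *)

Section Congruence.
Variables (n : nat) (u v : word n).

Lemma sstep_ctx p q x y : sstep u v x y -> sstep u v (p ++ x ++ q) (p ++ y ++ q).
Proof. by move=> [s [t [-> ->]]]; exists (p ++ s), (t ++ q); rewrite !catA. Qed.

Lemma sstep_rev x y : sstep u v x y -> sstep (rev u) (rev v) (rev x) (rev y).
Proof. by move=> [p [q [-> ->]]]; exists (rev q), (rev p); rewrite !rev_cat !catA. Qed.

Lemma irreducible_infix x : irreducible (sstep u v) x <-> ~~ infix u x.
Proof.
split=> [irr|ux y [p [q [ex _]]]]; last by rewrite ex infix_infix in ux.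
by apply/negP => /infixP[p [q ex]]; apply: (irr (p ++ v ++ q)); exists p, q.
Qed.

Lemma congS_ctx p q x y : congS u v x y -> congS u v (p ++ x ++ q) (p ++ y ++ q).
Proof. by apply: (clos_rst_homo (f := fun w => p ++ w ++ q)) => a b; exact: sstep_ctx. Qed.

Lemma congS_rev x y : congS u v x y -> congS (rev u) (rev v) (rev x) (rev y).
Proof. exact/clos_rst_homo/sstep_rev. Qed.

Lemma congS_size x y : size u = size v -> congS u v x y -> size x = size y.
Proof.
by move=> suv; apply: clos_rst_invariant => _ _ [p [q [-> ->]]]; rewrite !size_cat suv.
Qed.

Definition unique_normal_forms : Prop :=
  forall x, exists! y, congS u v x y /\ ~~ infix u y.

Lemma normal_form_inj x y : unique_normal_forms ->
  ~~ infix u x -> ~~ infix u y -> congS u v x y -> x = y.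
Proof.
move=> nf ux uy xy; have [z [_ zP]] := nf x.
by rewrite -(zP x) ?(zP y) //; split=> //; exact: rst_refl.
Qed.
End Congruence.

Lemma congS_revE (n : nat) (u v x y : word n) :
  congS (rev u) (rev v) (rev x) (rev y) <-> congS u v x y.
Proof. by split=> /congS_rev; rewrite ?revK. Qed.

Lemma unique_normal_forms_rev (n : nat) (u v : word n) :
  unique_normal_forms u v -> unique_normal_forms (rev u) (rev v).
Proof.
move=> nf x; have [y [[xy uy] yP]] := nf (rev x).
exists (rev y); split=> [|z [xz uz]].
  by rewrite infix_rev -[x]revK congS_revE.
by rewrite (yP (rev z)) ?revK // -congS_revE -infix_rev !revK.
Qed.

Section GroebnerShirshov.
Variables (F : fieldType) (n : nat) (sigma : {perm 'I_n}) (u v : word n).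
Hypothesis GS : GS_basis F sigma [:: (u, v)].

Let rank := deglex_rank sigma.

Lemma GS_basis_deglt : deglt sigma v u.
Proof. by case: GS => /(_ (u, v)) + _; apply; exact: mem_head. Qed.

Lemma GS_basis_neq : u <> v.
Proof. by move=> uv; have := deglt_rank GS_basis_deglt; rewrite uv ltnn. Qed.

Lemma sstep_rank x y : sstep u v x y -> rank y < rank x.
Proof.
by move=> [p [q [-> ->]]]; apply/deglex_rank_ctx/deglt_rank/GS_basis_deglt.
Qed.

Lemma connected_below_ctx w p q x y :
  connected_below (sstep u v) rank w x y ->
  connected_below (sstep u v) rank (p ++ w ++ q) (p ++ x ++ q) (p ++ y ++ q).
Proof.
apply: (clos_rst_homo (f := fun t => p ++ t ++ q)) => a b [ab aw].
by split; [exact: sstep_ctx | exact: deglex_rank_ctx].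
Qed.

Lemma overlap_connected a b : u ++ b = a ++ u -> size a < size u ->
  connected_below (sstep u v) rank (u ++ b) (v ++ b) (a ++ v).
Proof.
move=> uba au; set conn := connected_below _ _ _.
have sb : size b = size a by have := congr1 size uba; rewrite !size_cat; lia.
pose C := [pred x | `[< conn (v ++ b) x >]].
have C_invariant : invariant_below sigma [:: (u, v)] (u ++ b) C.
  move=> rel l r; rewrite inE => /eqP-> /= /deglt_rank lt.
  have lr : conn (l ++ u ++ r) (l ++ v ++ r) by apply: rst_step; split=> //; exists l, r.
  apply/asboolP/asboolP => conn_v; first exact: rst_trans lr.
  exact: rst_trans (rst_sym _ _ _ _ lr).
case: GS => _ /(_ (u, v) (u, v)); rewrite !inE eqxx => /(_ isT isT)[+ _].
move=> /(_ (u ++ b) a b erefl uba); rewrite size_cat sb ltn_add2l => /(_ au).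
move=> /(trivial_composition_invariant (f := (u, v)) (g := (u, v)) C_invariant uba) /= eC.
apply/asboolP; rewrite -[X in is_true X]eC; apply/asboolP; exact: rst_refl.
Qed.

Lemma sstep_peaks_connected w x y :
  sstep u v w x -> sstep u v w y -> connected_below (sstep u v) rank w x y.
Proof.
move=> wx wy; have [xw yw] := (sstep_rank wx, sstep_rank wy).
case: wx wy => p [q [ew ex]] [p' [q' [ew' ey]]].
wlog pp' : p q p' q' x y xw yw ew ex ew' ey / size p <= size p'.
  move=> peak; have [pp'|/ltnW p'p] := leqP (size p) (size p').
    exact: peak ew ex ew' ey pp'.
  by apply: rst_sym; exact: peak ew' ey ew ex p'p.
have := two_occurrences (etrans (esym ew) ew') pp'.
case=> [[d ep' dq]|[a [b [ep' bq uba au]]]].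
  apply: (rst_trans _ _ _ (p ++ v ++ d ++ v ++ q')); last apply: rst_sym; apply: rst_step.
    by split=> //; exists (p ++ v ++ d), q'; rewrite ex dq -!catA.
  by split=> //; exists p, (d ++ v ++ q'); rewrite ey ep' -!catA.
have := connected_below_ctx p q' (overlap_connected uba au).
by rewrite ew ex ey ep' bq -!catA.
Qed.

Lemma GS_basis_unique_normal_forms : unique_normal_forms u v.
Proof.
move=> x; have [y [[xy irr] yP]] :=
  connected_peaks_unique_normal_form sstep_rank sstep_peaks_connected x.
exists y; split=> [|z [xz /irreducible_infix uz]]; last exact: yP.
by split=> //; apply/irreducible_infix.
Qed.
End GroebnerShirshov.

(** * Cascades of reductions *)

Section Cascade.
Variables (T : eqType) (u v : seq T).
Implicit Types g p z x y : seq T.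

(* [cascade p z] describes the chain of reductions of [p ++ u] to [v ++ z] in which each
   [u] straddles the left end of the [v] just produced. *)
Inductive cascade : seq T -> seq T -> Prop :=
| cascade_nil : cascade [::] [::]
| cascade_cons u' s v' p z : 0 < size u' -> 0 < size s -> u = u' ++ s -> v = s ++ v' ->
    cascade p z -> cascade (u' ++ p) (v' ++ z).

Definition cascade_pair x y : Prop :=
  x = y \/ exists g p z, [/\ cascade p z, x = g ++ p ++ u & y = g ++ v ++ z].

(* No reduction of a cascade creates a [u] further to the right. *)
Definition leftward : Prop := forall p z, cascade p z -> ~~ infix u (v ++ z).

Lemma cascade_cat p z p' z' : cascade p z -> cascade p' z' -> cascade (p ++ p') (z ++ z').
Proof.
move=> c c'; elim: c => // u' s v' q t u0 s0 eu ev _ IH.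
by rewrite -!catA; exact: (cascade_cons u0 s0 eu ev IH).
Qed.

Hypothesis suv : size u = size v.

Lemma cascade_size p z : cascade p z -> size p = size z.
Proof.
elim=> // u' s v' q t _ _ eu ev _ IH; move: suv.
by rewrite eu ev !size_cat IH; lia.
Qed.

Lemma cascade_reduce g p z : leftward -> ~~ infix u g -> cascade p z ->
  exists g' p' z', [/\ cascade p' z', g ++ p = g' ++ p' & ~~ infix u (g' ++ v ++ z')].
Proof.
move=> lw; have [m] := ubnP (size g); elim: m g p z => // m IH g p z gm ug c.
have [/infixP[a [b e]]|irr] := boolP (infix u (g ++ v ++ z)); last by exists g, p, z.
have [ga|ag] := leqP (size g) (size a).
  have [d _ ed] := cat_levi e ga.
  by have := lw _ _ c; rewrite ed infix_infix.
have [u' eg eu] := cat_levi (esym e) (ltnW ag); rewrite {}eg ?size_cat in gm ug ag *.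
have u'u : size u' < size u.
  rewrite ltnNge; apply/negP => /(cat_levi eu)[d ed _].
  by rewrite ed infix_infix in ug.
have [s es ez] := cat_levi (esym eu) (ltnW u'u).
have [|v' ev _] := cat_levi (esym ez); first by rewrite -suv es size_cat leq_addl.
have s0 : 0 < size s by move: u'u; rewrite es size_cat; lia.
have [|||g' [p' [z' [c' ep irr]]]] := IH a (u' ++ p) (v' ++ z).
- by lia.
- by apply: contraNN ug; exact: infix_catr.
- by apply: (cascade_cons _ s0 es ev c); lia.
by exists g', p', z'; split; rewrite // -catA.
Qed.

Lemma cascade_normal_form g : leftward -> ~~ infix u g ->
  exists2 y, cascade_pair (g ++ u) y & ~~ infix u y.
Proof.
move=> lw ug; have [g' [p [z [c ep irr]]]] := cascade_reduce lw ug cascade_nil.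
exists (g' ++ v ++ z) => //; right; exists g', p, z; split=> //.
by rewrite catA -ep cats0.
Qed.

Lemma cascade_pair_normal_form x w : leftward -> ~~ infix u x -> size w <= 1 ->
  exists2 y, cascade_pair (x ++ w) y & ~~ infix u y.
Proof.
move=> lw ux; have [uxw|uxw] := boolP (infix u (x ++ w)); last first.
  by exists (x ++ w) => //; left.
case: w uxw => [|a [|]] //; rewrite ?cats0 ?cats1 => uxa _; first by rewrite uxa in ux.
by have [g -> ug] := infix_rcons_suffix ux uxa; exact: cascade_normal_form.
Qed.

Lemma cascade_split p z r x : cascade p z -> p ++ u = r ++ x ->
  exists p1 z1 r', [/\ cascade p1 z1, r = p1 ++ r', size r' <= size u &
    exists p2 z2, [/\ cascade p2 z2, z = z1 ++ z2 & p2 ++ u = r' ++ x]].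
Proof.
move=> c; elim: c r => [|u' s v' q t u'0 s0 eu ev c IH] r e.
  exists [::], [::], r; split=> //; first exact: cascade_nil.
    by rewrite (e : u = _) size_cat leq_addr.
  by exists [::], [::]; split=> //; exact: cascade_nil.
have [ru'|u'r] := leqP (size r) (size u').
  exists [::], [::], r; split=> //; first exact: cascade_nil.
    by rewrite eu size_cat; lia.
  by exists (u' ++ q), (v' ++ t); split=> //; exact: (cascade_cons u'0 s0 eu ev c).
rewrite -catA in e; have [r1 -> e1] := cat_levi e (ltnW u'r).
have [p1 [z1 [r' [c1 -> r'u [p2 [z2 [c2 -> e2]]]]]]] := IH _ e1.
exists (u' ++ p1), (v' ++ z1), r'; split; rewrite -?catA //.
  exact: (cascade_cons u'0 s0 eu ev c1).
by exists p2, z2; rewrite -catA.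
Qed.

(* Inside a cascade, [r] is the part of an unfinished [u'] read so far in the first word
   and [s] the letters that the second word still owes. *)
Definition pending x y r s : Prop :=
  exists g p z, [/\ cascade p z, x = g ++ p ++ r & y ++ s = g ++ v ++ z].

Definition completes r s x y : Prop :=
  exists p z, [/\ cascade p z, p ++ u = r ++ x & y = s ++ z].

Lemma cascade_pair_cat x1 x2 y1 y2 : size x1 = size y1 ->
  cascade_pair (x1 ++ x2) (y1 ++ y2) <->
  (x1 = y1 /\ cascade_pair x2 y2) \/
  (exists r s, [/\ size r <= size u, size s <= size u, pending x1 y1 r s &
    completes r s x2 y2]).
Proof.
move=> sxy; split; last first.
  case=> [[-> [->|[g [p [z [c -> ->]]]]]]|]; first by left.
    by right; exists (y1 ++ g), p, z; rewrite -!catA.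
  case=> r [s [_ _ [g [p [z [c -> e]]]] [p' [z' [c' e' ->]]]]].
  right; exists g, (p ++ p'), (z ++ z'); split; first exact: cascade_cat.
    by rewrite -!catA e'.
  by rewrite catA e -!catA.
case=> [/eqP|[g [p [z [c ex ey]]]]].
  by rewrite eqseq_cat // => /andP[/eqP-> /eqP->]; left; split; [|left].
have [xg|gx] := leqP (size x1) (size g).
  have [g1 eg ex2] := cat_levi ex xg.
  have [|g2 eg' ey2] := cat_levi ey; first by rewrite -sxy.
  have /eqP := etrans (esym eg) eg'; rewrite eqseq_cat // => /andP[/eqP e1 /eqP e2].
  by left; split=> //; right; exists g1, p, z; rewrite e2 in ex2 *.
have [r er ex2] := cat_levi (esym ex) (ltnW gx).
have [p1 [z1 [r' [c1 er' r'u [p2 [z2 [c2 ez e2]]]]]]] := cascade_split c ex2.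
have sx := congr1 size er; rewrite er' !size_cat (cascade_size c1) in sx.
rewrite ez !catA in ey; have [|s es ey2] := cat_levi ey.
  by rewrite !size_cat -suv; lia.
right; exists r', s; split=> //.
- by have := congr1 size es; rewrite !size_cat -suv; lia.
- by exists g, p1, z1; rewrite er er' -es !catA.
- by exists p2, z2.
Qed.
End Cascade.

Lemma synchronous_cascade_pair (T : finType) (u v : seq T) :
  size u = size v -> synchronous (cascade_pair u v).
Proof.
move=> suv; apply/regular_nerodeP.
pose buffer := {bseq (size u) of T}.
exists _, (fun w => (unzip1 w == unzip2 w,
  [set b : buffer * buffer | `[< pending u v (unzip1 w) (unzip2 w) b.1 b.2 >]])).
move=> w1 w2 w [eq12 /setP pending12]; rewrite /unzip1 /unzip2 !map_cat.
rewrite -!/(unzip1 _) -!/(unzip2 _) !cascade_pair_cat ?size_map //.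
case=> [[/eqP e c]|[r [s [ru su]]] r_pending c].
  by left; split=> //; apply/eqP; rewrite -eq12.
right; exists r, s; split=> //; have := pending12 (Bseq ru, Bseq su).
by rewrite !inE /= => e; apply/asboolP; rewrite -e; apply/asboolP.
Qed.

(** * Overlaps that force cascades to the left *)

Section Borders.
Variable T : eqType.
Implicit Types e x y w : seq T.

Definition border e x : bool := [&& prefix e x, suffix e x & 0 < size e < size x].

Definition unbordered x : Prop := forall e, ~~ border e x.

Lemma borderI e x c d :
  x = e ++ c -> x = d ++ e -> 0 < size e < size x -> border e x.
Proof.
move=> xc xd sizes; rewrite /border sizes andbT; apply/andP; split.
  by rewrite xc prefix_prefix.
by rewrite xd suffix_suffix.
Qed.

(* A proper border of minimal length does not overlap itself. *)
Lemma unbordered_sandwich x :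
  (forall w w', 0 < size w -> x <> w ++ w' ++ w) -> unbordered x.
Proof.
move=> xw e; have [m] := ubnP (size e); elim: m e => // m IH e em; apply/negP.
case/and3P=> /prefixP[d xd] /suffixP[c xc] /andP[e0 ex].
have [ec|ce] := leqP (size e) (size c).
  have [f cf _] := cat_levi (etrans (esym xd) xc) ec.
  by apply: (xw e f) => //; rewrite xc cf catA.
have [f ef fd] := cat_levi (etrans (esym xc) xd) (ltnW ce).
have se : size e = size c + size f by rewrite {1}ef size_cat.
have sx : size x = size c + size e by rewrite xc size_cat.
have fm : size f < m by lia.
apply: (negP (IH f fm)); apply: (@borderI _ _ (d ++ d) (c ++ c)); last by lia.
  by rewrite catA -fd.
by rewrite -catA -ef.
Qed.

Lemma uniq_unbordered x : uniq x -> unbordered x.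
Proof.
move=> x_uniq [|a e]; apply/negP => /and3P[/prefixP[c xc] /suffixP[[|b d] xd]] //.
  by rewrite xd ltnn.
by move: x_uniq; rewrite xd; move: xd; rewrite xc /= => -[<- _]; rewrite mem_cat mem_head orbT.
Qed.

End Borders.

Section LeftwardCriteria.
Variables (T : eqType) (u v : seq T).
Hypotheses (suv : size u = size v) (uv : u <> v).

Section ForbiddenOverlaps.
Hypothesis no_long_border : forall e, border e u -> size u <= (size e).+1.
Hypothesis no_exchange : forall s m w, 0 < size s -> 0 < size w ->
  u = w ++ m ++ s -> v = s ++ m ++ w -> ~~ (prefix s w || prefix w s).

(* In [v ++ v' ++ t = a ++ u ++ b] let [w] be the part of [u] inside [v].  If [s] and [w]
   overlap in [v], the overlap is a border of [u]; otherwise [u = w m s] and [v = s m w], and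
   [s] and [w] are prefixes of the same word. *)
Lemma no_straddling_occurrence u' s v' a w r t b :
  0 < size u' -> 0 < size s -> 0 < size a -> 0 < size w ->
  u = u' ++ s -> v = s ++ v' -> v = a ++ w -> u = w ++ r -> v' ++ t <> r ++ b.
Proof.
move=> u'0 s0 a0 w0 eu ev ev' eu' e.
have := congr1 size eu'; have := congr1 size ev'; have := congr1 size ev; have := congr1 size eu.
rewrite !size_cat => su'_s ss_v' sa_w sw_r.
have [sw|ws] := leqP (size s + size w) (size u).
  have [|m em er] := cat_levi (etrans (esym eu') eu); first by lia.
  have [|m' em' er'] := cat_levi (etrans (esym ev) ev'); first by lia.
  have /eqP := e; rewrite er er' -!catA eqseq_cat; last first.
    by have := congr1 size em; have := congr1 size em'; rewrite !size_cat; lia.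
  case/andP=> /eqP m'm /eqP wtsb.
  have := no_exchange (s := s) (m := m) (w := w) s0 w0.
  rewrite {1}eu {1}ev em er' m'm catA => /(_ erefl erefl)/norP[/negP sw' /negP ws'].
  have [le|/ltnW le] := leqP (size s) (size w).
    by have [c ec _] := cat_levi (esym wtsb) le; rewrite ec prefix_prefix in sw'.
  by have [c ec _] := cat_levi wtsb le; rewrite ec prefix_prefix in ws'.
have [|c es ew] := cat_levi (etrans (esym ev') ev); first by lia.
have sa_c := congr1 size es; rewrite size_cat in sa_c.
have c_border : border c u.
  apply: (@borderI _ _ _ (v' ++ r) (u' ++ a)); last by lia.
    by rewrite catA -ew.
  by rewrite -catA -es.
by have := no_long_border c_border; lia.
Qed.

Lemma forbidden_overlaps_leftward : leftward u v.
Proof.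
move=> p z; elim=> [|u' s v' q t u'0 s0 eu ev _ IH].
  by rewrite cats0; apply/negP => /(infix_eq_size suv).
apply/negP => /infixP[a [b e]].
have [va|av] := leqP (size v) (size a).
  have [d _ ed] := cat_levi e va.
  by rewrite ev -catA ed catA infix_infix in IH.
have [w ev' ew] := cat_levi (esym e) (ltnW av).
have sv := congr1 size ev'; rewrite size_cat in sv.
have [|r eu' er] := cat_levi (esym ew); first by rewrite suv sv leq_addl.
have a0 : 0 < size a.
  rewrite lt0n; apply/eqP => /size0nil a0; apply: uv.
  by apply/esym/(infix_eq_size (esym suv)); rewrite ev' a0 eu' prefix_infix.
by apply: (no_straddling_occurrence _ _ _ _ eu ev ev' eu' er) => //; lia.
Qed.
End ForbiddenOverlaps.

Lemma unbordered_leftward : unbordered u -> unbordered v -> leftward u v.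
Proof.
move=> ub vb; apply: forbidden_overlaps_leftward => [e|s m w s0 w0 eu ev].
  by rewrite (negbTE (ub e)).
have := congr1 size eu; rewrite !size_cat => su.
apply/norP; split; apply/negP => /prefixP[c ec].
  apply: (negP (ub s)); apply: (@borderI _ _ _ (c ++ m ++ s) (w ++ m)); last by lia.
    by rewrite catA -ec.
  by rewrite -catA.
apply: (negP (vb w)); apply: (@borderI _ _ _ (c ++ m ++ w) (s ++ m)); last by rewrite -suv; lia.
  by rewrite catA -ec.
by rewrite -catA.
Qed.

Lemma uniq_leftward : uniq u -> leftward u v.
Proof.
move=> u_uniq; apply: forbidden_overlaps_leftward => [e|[|x s] m [|y w] // _ _ eu _].
  by rewrite (negbTE (uniq_unbordered u_uniq e)).
apply/negP; rewrite !prefix_cons => xy; move: u_uniq; rewrite eu.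
have -> : x = y by case/orP: xy => /andP[/eqP].
by rewrite /= !mem_cat mem_head !orbT.
Qed.

Lemma size2_leftward : size u = 2 -> leftward u v.
Proof.
move=> u2; apply: forbidden_overlaps_leftward => [e|s m w s0 w0 eu ev].
  by rewrite u2; case/and3P=> _ _ /andP[].
have := congr1 size eu; rewrite u2 !size_cat => sz.
have /size0nil m0 : size m = 0 by lia.
have sw : size s = size w by lia.
apply/negP => sw_prefix; apply: uv; rewrite eu ev m0; suff -> : s = w by [].
by case/orP: sw_prefix => /prefixW/infix_eq_size-> //.
Qed.

Lemma no_overlap_leftward :
  (forall s, 0 < size s -> suffix s u -> ~~ prefix s v) -> leftward u v.
Proof.
move=> no_overlap p z; case=> [|u' s v' q t _ s0 eu ev _].
  by rewrite cats0; apply/negP => /(infix_eq_size suv).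
by have := no_overlap s s0; rewrite eu ev suffix_suffix prefix_prefix => /(_ isT).
Qed.

Lemma cascade_subset p z : cascade u v p z -> {subset z <= v}.
Proof.
elim=> // u' s v' q t _ _ _ ev _ IH x; rewrite mem_cat => /orP[xv'|/IH //].
by rewrite ev mem_cat xv' orbT.
Qed.

Lemma missing_letter_leftward : ~ {subset u <= v} -> leftward u v.
Proof.
move=> missing p z /cascade_subset zv; apply/negP => /mem_infix uvz; apply: missing => x.
by move/uvz; rewrite mem_cat => /orP[|/zv].
Qed.
End LeftwardCriteria.

Section Conditions.
Variable T : eqType.
Implicit Types u v s : seq T.

Definition overlap_condition u v : Prop :=
  (forall t, 1 <= t -> pref t v <> suff t u /\ suff t v <> pref t u)
  \/ size (undup u) = size u
  \/ size u = 2
  \/ ~ {subset u <= v}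
  \/ (forall w w' s s' : seq T, w <> [::] -> s <> [::] ->
         u <> w ++ w' ++ w /\ v <> s ++ s' ++ s).

Lemma overlap_condition_leftward u v :
  size u = size v -> u <> v -> overlap_condition u v -> leftward u v.
Proof.
move=> suv uv [no_overlap|[u_uniq|[u2|[missing|no_border]]]].
- apply: no_overlap_leftward => // s s0; rewrite suffixE prefixE => /eqP us.
  by apply/eqP => vs; case: (no_overlap _ s0) => + _; rewrite /pref /suff us vs; exact.
- by apply: uniq_leftward => //; rewrite -[uniq u]negbK -ltn_size_undup u_uniq ltnn.
- exact: size2_leftward.
- exact: missing_letter_leftward.
- have pos (w : seq T) : 0 < size w -> w <> [::] by case: w.
  apply: unbordered_leftward => //; apply: unbordered_sandwich => w w' /pos w0;
  by have [] := no_border w w' w w' w0 w0.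
Qed.

Lemma pref_rev t s : pref t (rev s) = rev (suff t s).
Proof. exact: take_rev. Qed.

Lemma suff_rev t s : suff t (rev s) = rev (pref t s).
Proof. by rewrite -[in RHS](revK s) pref_rev revK. Qed.

Lemma overlap_condition_rev u v : overlap_condition u v -> overlap_condition (rev u) (rev v).
Proof.
rewrite /overlap_condition !size_rev.
case=> [no_overlap|[u_uniq|[u2|[missing|no_border]]]].
- left=> t /no_overlap[vu uv]; rewrite !pref_rev !suff_rev.
  by split=> /(can_inj revK).
- by right; left; rewrite (perm_size (perm_undup (mem_rev u))).
- by do 2 right; left.
- by do 3 right; left=> sub; apply: missing => x; have := sub x; rewrite !mem_rev.
- have rev_nonempty (x : seq T) : x <> [::] -> rev x <> [::].
    by move=> x0 /(canRL revK); exact: x0.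
  do 4 right; move=> w w' s s' /rev_nonempty w0 /rev_nonempty s0.
  have [uw vs] := no_border _ (rev w') _ (rev s') w0 s0.
  by split=> /(canRL revK); rewrite !rev_cat -catA.
Qed.
End Conditions.

(** * Automatic structures *)

Definition normal_word (T : eqType) (u x : seq T) : Prop := x != [::] /\ ~~ infix u x.

Lemma normal_word_rev (T : eqType) (u x : seq T) :
  normal_word (rev u) (rev x) <-> normal_word u x.
Proof. by rewrite /normal_word -!size_eq0 size_rev infix_rev. Qed.

Lemma regular_normal_word (T : finType) (u : seq T) : regular (normal_word u).
Proof.
have suff_size (x : seq T) : size (suff (size u) x) <= size u by rewrite size_drop; lia.
pose f x := (x == [::], infix u x, Bseq (suff_size x) : {bseq (size u) of T}).
apply/regular_nerodeP; exists _, f => x y z [e0 eu es]; rewrite /normal_word.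
rewrite (infix_cat_suff u x) (infix_cat_suff u y) eu es.
by rewrite -!size_eq0 !size_cat !addn_eq0 !size_eq0 e0.
Qed.

Section Padding.
Variable B : finType.
Implicit Types (al be : seq B) (L : seq B -> Prop).

Lemma padR_addn m al be : size be = size al + m ->
  padR al be = zip (map Some al ++ nseq m None) (map Some be).
Proof.
by move=> s; rewrite /padR s (maxn_idPr (leq_addr _ _)) addKn subnn cats0.
Qed.

Lemma padL_addn m al be : size be = size al + m ->
  padL al be = zip (nseq m None ++ map Some al) (map Some be).
Proof. by move=> s; rewrite /padL s (maxn_idPr (leq_addr _ _)) addKn subnn. Qed.

Lemma padL_rev al be : padL (rev al) (rev be) = rev (padR al be).
Proof.
rewrite /padL /padR !size_rev rev_zip; last first.
  by rewrite !size_cat !size_map !size_nseq !subnKC ?leq_maxl ?leq_maxr.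
by rewrite !rev_cat !rev_nseq !map_rev.
Qed.

Lemma padR_rev al be : padR (rev al) (rev be) = rev (padL al be).
Proof. by rewrite -[al in RHS]revK -[be in RHS]revK padL_rev revK. Qed.

Lemma regular_rpadded L m :
  regular L -> regular (fun t => exists2 al, L al & t = map Some al ++ nseq m None).
Proof.
move=> L_regular; elim: m => [|m IH].
  apply: regular_ext (regular_image some L_regular) => t.
  by split=> -[al Lal ->]; exists al => //; rewrite cats0.
have paddedS al : map some al ++ nseq m.+1 None = rcons (map some al ++ nseq m None) None.
  by rewrite -[m.+1]addn1 nseqD catA cats1.
apply: regular_ext (regular_rcons None IH) => t; split=> [[_ [al Lal ->] ->]|[al Lal ->]].
  by exists al; rewrite // paddedS.
by exists (map some al ++ nseq m None); rewrite ?paddedS //; exists al.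
Qed.

Lemma regular_lpadded L m :
  regular L -> regular (fun t => exists2 al, L al & t = nseq m None ++ map Some al).
Proof.
move=> /regular_rev/(regular_rpadded m)/regular_rev; apply: regular_ext => t.
split=> [[al Lal /(canRL revK)->]|[al Lal ->]].
  by exists (rev al) => //; rewrite rev_cat rev_nseq map_rev.
by exists (rev al); rewrite ?revK // rev_cat rev_nseq map_rev.
Qed.

Definition fills (a : option B) (t : seq (option B)) (x : seq B) : Prop :=
  map (oapp Some a) t = map Some x.

Lemma regular_filled (a : option B) (R : seq B -> seq B -> Prop) :
  synchronous R ->
  regular (fun w : seq (option B * option B) => exists x y,
    [/\ R x y, size x = size y, fills a (unzip1 w) x & unzip2 w = map Some y]).
Proof.
pose fill (c : option B * option B) := (oapp Some a c.1, c.2).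
move=> /(regular_image (fun c => (Some c.1, Some c.2)))/(regular_map fill).
apply: regular_ext => w; split=> [[o Ro e]|[x [y [Rxy sxy ex ey]]]].
  exists (unzip1 o), (unzip2 o); split=> //; first by rewrite !size_map.
    by have := congr1 (map fst) e; rewrite /fills -!map_comp.
  by have := congr1 (map snd) e; rewrite -!map_comp.
exists (zip x y); first by rewrite unzip1_zip ?unzip2_zip ?sxy.
have -> : map fill w = zip (map (oapp Some a) (unzip1 w)) (unzip2 w).
  by rewrite -map_comp zip_map.
by rewrite ex ey; elim: x y sxy {Rxy ex ey} => [|c x IH] [|d y] //= [/IH->].
Qed.

Definition padded_relation (pad : seq B -> seq B -> seq (option B * option B)) L
    (R : seq B -> seq B -> Prop) (w : seq (A2 B)) : Prop :=
  exists al be, L al /\ L be /\ map val w = pad al be /\ R al be.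

Lemma regular_padded (pad : seq B -> seq B -> seq (option B * option B)) (a : option B)
    (track : seq B -> seq (option B)) (fill : seq B -> seq B) L R :
  (forall al be, size be = size al + size (owrd a) -> pad al be = zip (track al) (map Some be)) ->
  (forall al, fills a (track al) (fill al)) ->
  (forall al, size (fill al) = size al + size (owrd a)) ->
  regular L -> regular (fun t => exists2 al, L al & t = track al) -> synchronous R ->
  regular (padded_relation pad L
    (fun al be => size be = size al + size (owrd a) /\ R (fill al) be)).
Proof.
move=> padE fillE size_fill L_regular track_regular /(regular_filled a) R_regular.
have size_track al : size (track al) = size (fill al).
  by rewrite -(size_map (oapp Some a)) fillE size_map.
have left_regular := regular_map (fst : option B * option B -> _) track_regular.
have right_regular := regular_map (snd : option B * option B -> _) (regular_image some L_regular).
have := regular_and left_regular (regular_and right_regular R_regular).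
move=> /(regular_map (val : A2 B -> _)); apply: regular_ext => w.
rewrite -/(unzip1 _) -/(unzip2 _); split.
  case=> -[al Lal e1] [[be Lbe e2] [x [y [Rxy sxy]]]].
  have some_inj : injective (map (@Some B)) by apply: inj_map => ? ? [].
  rewrite e1 e2 /fills fillE => /some_inj ex /some_inj ey; rewrite -{}ex -{}ey in Rxy sxy.
  have sbe : size be = size al + size (owrd a) by rewrite -sxy size_fill.
  by exists al, be; rewrite padE // -e1 -e2 zip_unzip.
case=> al [be [Lal [Lbe [e [sbe Rbe]]]]]; rewrite e padE //.
have tracks_size : size (track al) = size (map Some be).
  by rewrite size_track size_fill size_map.
rewrite unzip1_zip ?unzip2_zip ?tracks_size //.
split; [by exists al | split; [by exists be | exists (fill al), be]].
by rewrite size_fill sbe.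
Qed.

Lemma regular_padR (a : option B) L (R : seq B -> seq B -> Prop) :
  regular L -> synchronous R ->
  regular (padded_relation (@padR B) L
    (fun al be => size be = size al + size (owrd a) /\ R (al ++ owrd a) be)).
Proof.
move=> L_regular; apply: (regular_padded (@padR_addn (size (owrd a)))) => //.
- by move=> al; rewrite /fills !map_cat -map_comp; case: a.
- by move=> al; rewrite size_cat.
- exact: regular_rpadded.
Qed.

Lemma regular_padL (a : option B) L (R : seq B -> seq B -> Prop) :
  regular L -> synchronous R ->
  regular (padded_relation (@padL B) L
    (fun al be => size be = size al + size (owrd a) /\ R (al ++ owrd a) be)).
Proof.
move=> L_regular R_regular.
have rot_regular : synchronous (fun x y => R (rot (size (owrd a)) x) y).
  case: a => [a|]; first exact: synchronous_rot1.
  by apply: regular_ext R_regular => w; rewrite rot0.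
have fillE al : fills a (nseq (size (owrd a)) None ++ map Some al) (owrd a ++ al).
  by rewrite /fills !map_cat -map_comp; case: a {R_regular rot_regular}.
have size_fill al : size (owrd a ++ al) = size al + size (owrd a).
  by rewrite size_cat addnC.
have := regular_padded (@padL_addn _) fillE size_fill L_regular
  (regular_lpadded _ L_regular) rot_regular.
apply: regular_ext => w.
by split=> -[al [be [Lal [Lbe [e [sbe Rbe]]]]]]; exists al, be; move: Rbe; rewrite rot_size_cat.
Qed.

Lemma regular_padded_rev pad pad' L L' (Q Q' : seq B -> seq B -> Prop) :
  (forall al be, pad (rev al) (rev be) = rev (pad' al be)) ->
  (forall al, L (rev al) <-> L' al) -> (forall al be, Q (rev al) (rev be) <-> Q' al be) ->
  regular (padded_relation pad' L' Q') -> regular (padded_relation pad L Q).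
Proof.
move=> pad_rev LE QE /regular_rev; apply: regular_ext => w.
split=> -[al [be [Lal [Lbe [e Qab]]]]]; exists (rev al), (rev be).
  do 2 (split; first exact/LE); split; last exact/QE.
  by rewrite pad_rev -e map_rev revK.
split; first by apply/LE; rewrite revK.
split; first by apply/LE; rewrite revK.
split; last by apply/QE; rewrite !revK.
by apply: (can_inj revK); rewrite -pad_rev !revK map_rev revK.
Qed.
End Padding.

Definition letter (n : nat) (a : 'I_n) : word n := [:: a].

Lemma phi_letter (n : nat) (x : word n) : phi (@letter n) x = x.
Proof. exact: flatten_seq1. Qed.

Section Structure.
Variables (n : nat) (u v : word n).
Hypotheses (suv : size u = size v) (nf : unique_normal_forms u v).

Lemma cascade_congS p z : cascade u v p z -> congS u v (p ++ u) (v ++ z).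
Proof.
elim=> [|u' s v' q t _ _ eu ev _ IH].
  by rewrite cats0; apply: rst_step; exists [::], [::]; rewrite !cats0.
apply: (rst_trans _ _ _ (u' ++ v ++ t)).
  by have := congS_ctx u' [::] IH; rewrite !cats0 -catA.
by apply: rst_step; exists [::], (v' ++ t); rewrite {1}ev eu -!catA.
Qed.

Lemma cascade_pair_congS x y : cascade_pair u v x y -> congS u v x y.
Proof.
case=> [->|[g [p [z [c -> ->]]]]]; first exact: rst_refl.
by have := congS_ctx g [::] (cascade_congS c); rewrite !cats0.
Qed.

Lemma congS_cascade_pair x w y : leftward u v ->
  ~~ infix u x -> ~~ infix u y -> size w <= 1 ->
  congS u v (x ++ w) y <-> cascade_pair u v (x ++ w) y.
Proof.
move=> lw ux uy w1; split; last exact: cascade_pair_congS.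
have [z xwz uz] := cascade_pair_normal_form suv lw ux w1 => xwy.
rewrite (normal_form_inj nf uy uz) //.
exact: rst_trans (rst_sym _ _ _ _ xwy) (cascade_pair_congS xwz).
Qed.

Lemma eqS_cascade_pair x y a : leftward u v -> normal_word u x -> normal_word u y ->
  eqS u v (@letter n) (x ++ owrd a) y <->
  size y = size x + size (owrd a) /\ cascade_pair u v (x ++ owrd a) y.
Proof.
move=> lw [_ ux] [_ uy]; rewrite /eqS !phi_letter.
have a1 : size (owrd a) <= 1 by case: a.
rewrite congS_cascade_pair //; split=> [xay|[]//]; split=> //.
by rewrite -size_cat (congS_size suv (cascade_pair_congS xay)).
Qed.

Lemma regular_right_multipliers a : leftward u v ->
  regular (LR u v (@letter n) (normal_word u) a) /\
  regular (LL u v (@letter n) (normal_word u) a).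
Proof.
move=> lw; have u_regular := regular_normal_word u.
have cascade_regular := synchronous_cascade_pair suv.
split; [apply: regular_ext (regular_padR a u_regular cascade_regular)
      | apply: regular_ext (regular_padL a u_regular cascade_regular)] => w;
by split=> -[al [be [Lal [Lbe [e Q]]]]]; exists al, be; do 3 split=> //; apply/eqS_cascade_pair.
Qed.

Lemma letter_gen_ok : 1 < size u -> gen_ok u v (@letter n).
Proof.
move=> u_gt1; split=> // b c.
have irr d : ~~ infix u (letter d).
  by apply: contraL u_gt1 => /size_infix; rewrite -leqNgt.
by case/(normal_form_inj nf (irr b) (irr c)).
Qed.

Lemma normal_word_lang_ok : lang_ok u v (@letter n) (normal_word u).
Proof.
split; [exact: regular_normal_word | split=> [x []//|x x0]].
have [y [[xy uy] _]] := nf x; exists y; rewrite phi_letter.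
split; last exact: rst_sym.
by split=> //; rewrite -size_eq0 -(congS_size suv xy) size_eq0.
Qed.

Lemma leftward_prefix_automatic : 1 < size u -> leftward u v -> prefix_automatic u v.
Proof.
move=> u_gt1 lw; exists 'I_n, (@letter n), (normal_word u).
split; first exact: letter_gen_ok.
split; first exact: normal_word_lang_ok.
split=> [a|]; first by case: (regular_right_multipliers a lw).
have [LR_regular _] := regular_right_multipliers None lw.
apply: regular_ext LR_regular => w; split=> -[al [be [Lal]]].
  case=> Lbe [e]; rewrite cats0 => albe; exists al, be; split=> //.
  by split; [exact: Lbe.1 | split; [exists [::]; rewrite cats0 | split]].
case=> be0 [[ga [_ u_bega]] [e albe]]; exists al, be; rewrite cats0; split=> //; split=> //.
by split=> //; apply: contraNN u_bega; exact: infix_catr.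
Qed.
End Structure.

Lemma regular_left_multipliers (n : nat) (u v : word n) a :
  size u = size v -> unique_normal_forms u v -> leftward (rev u) (rev v) ->
  regular (RL u v (@letter n) (normal_word u) a) /\
  regular (RLL u v (@letter n) (normal_word u) a).
Proof.
move=> suv nf lw.
have srev : size (rev u) = size (rev v) by rewrite !size_rev.
have [LR_regular LL_regular] :=
  regular_right_multipliers srev (unique_normal_forms_rev nf) a lw.
have normalE (x : word n) : normal_word u (rev x) <-> normal_word (rev u) x.
  by rewrite -normal_word_rev revK.
have eqSE (x y : word n) : eqS u v (@letter n) (owrd a ++ rev x) (rev y) <->
    eqS (rev u) (rev v) (@letter n) (x ++ owrd a) y.
  rewrite /eqS !phi_letter -congS_revE rev_cat !revK.
  by case: a {LR_regular LL_regular}.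
split; [exact: regular_padded_rev (@padR_rev _) normalE eqSE LL_regular
      | exact: regular_padded_rev (@padL_rev _) normalE eqSE LR_regular].
Qed.

Lemma leftward_biautomatic (n : nat) (u v : word n) :
  1 < size u -> size u = size v -> unique_normal_forms u v ->
  leftward u v -> leftward (rev u) (rev v) -> biautomatic u v.
Proof.
move=> u_gt1 suv nf lw lw_rev; exists 'I_n, (@letter n), (normal_word u).
split; first exact: letter_gen_ok.
split; first exact: normal_word_lang_ok.
move=> a; have [LR_regular LL_regular] := regular_right_multipliers suv nf a lw.
by have [] := regular_left_multipliers a suv nf lw_rev.
Qed.

Theorem theorem3p1p3 (F : fieldType) (n k : nat) (sigma : {perm 'I_n})
    (u v : word n) :
  (2 <= k)%N -> size u = k -> size v = k ->
  GS_basis F sigma [:: (u, v)] ->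
  ((forall t : nat, (1 <= t)%N -> pref t v <> suff t u /\ suff t v <> pref t u)
   \/ size (undup u) = k
   \/ k = 2
   \/ ~ {subset u <= v}
   \/ (forall w w' s s' : word n, w <> [::] -> s <> [::] ->
          u <> w ++ w' ++ w /\ v <> s ++ s' ++ s)) ->
  biautomatic u v /\ prefix_automatic u v.
Proof.
move=> u_gt1 su; rewrite -{}su in u_gt1 * => /esym suv GS cond.
have nf := GS_basis_unique_normal_forms GS.
have uv := GS_basis_neq GS.
have lw : leftward u v by exact: overlap_condition_leftward.
have lw_rev : leftward (rev u) (rev v).
  apply: overlap_condition_leftward; [by rewrite !size_rev | by move/(can_inj revK) |].
  exact: overlap_condition_rev.
by split; [exact: leftward_biautomatic | exact: leftward_prefix_automatic].
Qed.
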